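(* Let $n\geq 3$ and let $k$ be an even integer with $3\leq k\leq 2^{n-1}$. Then $\kappa(Q_n;C_k)\geq \kappa^s(Q_n;C_k)=\lceil\frac{2n}{k}\rceil$.
   Context: $Q_n$ is the $n$-dimensional hypercube: its vertices are the binary strings of length $n$, two vertices being adjacent iff they differ in exactly one position. $C_k$ denotes the cycle of length $k$. For connected graphs $G,H$: an $H$-structure cut of $G$ is a set $F$ of subgraphs of $G$, each isomorphic to $H$, such that $G-V(F)$ is disconnected or trivial (a single vertex); an $H$-substructure cut is defined the same way except that each member of $F$ is isomorphic to a connected subgraph of $H$. $\kappa(G;H)$ (resp. $\kappa^s(G;H)$) is the minimum cardinality of an $H$-structure cut (resp. $H$-substructure cut) of $G$. *)

(* Defs.v *)
From HB Require Import structures.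
From mathcomp Require Import all_boot all_order all_algebra.

Set Implicit Arguments.
Unset Strict Implicit.
Unset Printing Implicit Defensive.

Record sgraph := SGraph {
  vertex :> finType;
  adj : rel vertex;
  adj_sym : symmetric adj;
  adj_irrefl : irreflexive adj }.

Definition isomorphic (G H : sgraph) : bool :=
  [exists f : {ffun G -> H}, exists g : {ffun H -> G},
    [&& [forall x, g (f x) == x], [forall y, f (g y) == y]
      & [forall x, forall y, adj (f x) (f y) == adj x y]]].

Definition connected (G : sgraph) : bool :=
  (0 < #|G|) && [forall x : G, forall y : G, connect (@adj G) x y].

(* Not the negation of [connected]: the graph with no vertex is neither
   connected nor disconnected (nor trivial). *)
Definition disconnected (G : sgraph) : bool :=
  [exists x : G, exists y : G, ~~ connect (@adj G) x y].

Definition trivial_graph (G : sgraph) : bool := #|G| == 1.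

(* Edges are unordered pairs; a subgraph need not be induced. *)
Definition is_subgraph (G : sgraph) (p : {set G} * {set {set G}}) : bool :=
  [forall e in p.2,
    exists x in p.1, exists y in p.1, adj x y && (e == [set x; y])].

Definition subgraph (G : sgraph) : finType :=
  {p : {set G} * {set {set G}} | is_subgraph p}.

Definition verts (G : sgraph) (S : subgraph G) : {set G} := (val S).1.
Definition edges (G : sgraph) (S : subgraph G) : {set {set G}} := (val S).2.

Section GraphOfSubgraph.
Variables (G : sgraph) (S : subgraph G).

Definition sub_adj : rel {x : G | x \in verts S} :=
  fun x y => [set val x; val y] \in edges S.

Lemma sub_adj_sym : symmetric sub_adj.
Proof. by move=> x y; rewrite /sub_adj setUC. Qed.

Lemma sub_adj_irrefl : irreflexive sub_adj.
Proof.
move=> x; apply/negP => xS; have /forall_inP/(_ _ xS) := valP S.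
move=> /exists_inP[a _ /exists_inP[b _ /andP[ab /eqP E]]].
have : a \in [set val x; val x] by rewrite E set21.
have : b \in [set val x; val x] by rewrite E set22.
rewrite setUid !inE => /eqP eb /eqP ea.
by rewrite ea eb adj_irrefl in ab.
Qed.

Definition graph_of_subgraph : sgraph := SGraph sub_adj_sym sub_adj_irrefl.
End GraphOfSubgraph.

Section Deletion.
Variables (G : sgraph) (A : {set G}).

Definition del_adj : rel {x : G | x \notin A} := fun x y => adj (val x) (val y).

Lemma del_adj_sym : symmetric del_adj.
Proof. by move=> x y; apply: adj_sym. Qed.

Lemma del_adj_irrefl : irreflexive del_adj.
Proof. by move=> x; apply: adj_irrefl. Qed.

Definition delete_vertices : sgraph := SGraph del_adj_sym del_adj_irrefl.
End Deletion.

Definition cover_verts (G : sgraph) (F : {set subgraph G}) : {set G} :=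
  \bigcup_(S in F) verts S.

Definition separates (G : sgraph) (F : {set subgraph G}) : bool :=
  let G' := delete_vertices (cover_verts F) in
  disconnected G' || trivial_graph G'.

Definition structure_cut (G H : sgraph) (F : {set subgraph G}) : bool :=
  [forall S in F, isomorphic (graph_of_subgraph S) H] && separates F.

Definition substructure_cut (G H : sgraph) (F : {set subgraph G}) : bool :=
  [forall S in F, exists T : subgraph H,
     connected (graph_of_subgraph T)
     && isomorphic (graph_of_subgraph S) (graph_of_subgraph T)]
  && separates F.

(* The value 0 when no set satisfies P is a convention. If G is connected with
   at least two vertices, the empty set is not a cut, so the connectivities
   below are positive exactly when a cut exists. *)
Definition min_card (T : finType) (P : pred {set T}) : nat :=
  if [pick F | P F] is Some F0 then #|[arg min_(F < F0 | P F) #|F|]| else 0.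

Definition structure_connectivity (G H : sgraph) : nat :=
  min_card (@structure_cut G H).

Definition substructure_connectivity (G H : sgraph) : nat :=
  min_card (@substructure_cut G H).

Section Hypercube.
Variable n : nat.

Definition cube_adj : rel (n.-tuple bool) :=
  fun x y => #|[set i | tnth x i != tnth y i]| == 1.

Lemma cube_adj_sym : symmetric cube_adj.
Proof.
by move=> x y; congr (#|pred_of_set _| == 1); apply/setP=> i; rewrite !inE eq_sym.
Qed.

Lemma cube_adj_irrefl : irreflexive cube_adj.
Proof.
move=> x; rewrite /cube_adj (_ : [set _ | _] = set0) ?cards0 //.
by apply/setP=> i; rewrite !inE eqxx.
Qed.

Definition hypercube : sgraph := SGraph cube_adj_sym cube_adj_irrefl.
End Hypercube.

Section Cycle.
Variable k : nat.

(* [i != j] only matters for k = 1; this is the cycle C_k for 3 <= k. *)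
Definition cycle_adj : rel 'I_k :=
  fun i j => (i != j) && ((j == ordS i) || (i == ordS j)).

Lemma cycle_adj_sym : symmetric cycle_adj.
Proof. by move=> i j; rewrite /cycle_adj eq_sym orbC. Qed.

Lemma cycle_adj_irrefl : irreflexive cycle_adj.
Proof. by move=> i; rewrite /cycle_adj eqxx. Qed.

Definition cycle_graph : sgraph := SGraph cycle_adj_sym cycle_adj_irrefl.
End Cycle.

(* Main.v *)
Require Import Defs.
From mathcomp Require Import all_boot all_order all_algebra.
From mathcomp Require Import zify.

Set Implicit Arguments.
Unset Strict Implicit.
Unset Printing Implicit Defensive.

(* The bounds come from the bipartition of Q_n by parity. A member of a
   substructure cut has at most k/2 vertices of each parity, so if 2n > k|F| the
   deleted set K has fewer than n vertices of each parity. Then no vertex is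
   isolated, and an induction over subcubes shows that K has exactly n-1 vertices
   of each parity and that all edges inside K have one common direction. Members
   of F are connected inside K, hence have at most one vertex of each parity, so
   n-1 <= |F|, which contradicts k >= 4. Conversely, ceil(2n/k) paths e_q,
   e_q + e_r, e_r, ... isolate the origin. *)

(** * Vertex cuts of the hypercube by parity *)

Section Flip.
Variable n : nat.
Implicit Types (i j : 'I_n) (x y u : n.-tuple bool) (D : {set 'I_n})
  (A B K : {set n.-tuple bool}).

Definition flip i x : n.-tuple bool := [tuple tnth x j (+) (j == i) | j < n].

Definition par x : bool := \big[addb/false]_i tnth x i.

Lemma tnth_flip i x j : tnth (flip i x) j = tnth x j (+) (j == i).
Proof. by rewrite tnth_mktuple. Qed.

Lemma flipK i : involutive (flip i).
Proof. by move=> x; apply: eq_from_tnth => j; rewrite !tnth_flip addbK. Qed.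

Lemma flipC i j x : flip i (flip j x) = flip j (flip i x).
Proof. by apply: eq_from_tnth => l; rewrite !tnth_flip addbAC. Qed.

Lemma flip_inj_dir x : injective (flip^~ x).
Proof.
move=> i j /(congr1 (fun y => tnth y i)) /=.
by rewrite !tnth_flip eqxx => /addbI /esym/eqP.
Qed.

Lemma par_flip i x : par (flip i x) = ~~ par x.
Proof.
rewrite /par (eq_bigr (fun j => tnth x j (+) (j == i))); last first.
  by move=> j _; rewrite tnth_flip.
rewrite big_split /= [X in _ (+) X](bigD1 i) //= eqxx [X in true (+) X]big1 ?addbT //.
by move=> j /negbTE.
Qed.

Lemma cube_adjP x y : reflect (exists i, y = flip i x) (cube_adj x y).
Proof.
apply: (iffP cards1P) => [] [i].
  move/setP=> E; exists i; apply: eq_from_tnth => j; rewrite tnth_flip.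
  by have := E j; rewrite !inE => <-; case: (tnth x j) (tnth y j) => [] [].
move=> ->; exists i; apply/setP=> j; rewrite !inE tnth_flip.
by case: (tnth x j) (j == i) => [] [].
Qed.

Lemma cube_adj_flip i x : cube_adj x (flip i x).
Proof. by apply/cube_adjP; exists i. Qed.

(** [D] is the set of free directions and [u] fixes the remaining coordinates. Faces of all
    dimensions thus live in one vertex type, and the induction can run on [#|D|]. *)
Definition subcube D u : {set n.-tuple bool} :=
  [set x | [forall (i | i \notin D), tnth x i == tnth u i]].

Lemma subcubeP D u x :
  reflect (forall i, i \notin D -> tnth x i = tnth u i) (x \in subcube D u).
Proof. by rewrite inE; apply: (iffP forall_inP) => h i /h /eqP. Qed.

Lemma flip_subcube D u i x :
  i \in D -> (flip i x \in subcube D u) = (x \in subcube D u).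
Proof.
move=> iD; rewrite !inE; apply: eq_forallb_in => j jD.
by rewrite tnth_flip (eq_sym j) (negbTE (memPn jD _ iD)) addbF.
Qed.

Lemma card_subcube D u : #|subcube D u| <= 2 ^ #|D|.
Proof.
rewrite -card_powerset.
rewrite -(card_in_imset (f := fun x => [set i | tnth x i != tnth u i])); last first.
  move=> x y _ _ /setP E; apply: eq_from_tnth => i.
  by have := E i; rewrite !inE; case: (tnth x i) (tnth y i) (tnth u i) => [] [] [].
apply/subset_leq_card/subsetP=> _ /imsetP[x /subcubeP xD ->].
rewrite powersetE; apply/subsetP=> i; rewrite inE; apply: contraR => /xD ->.
exact: eqxx.
Qed.

(** * Parity classes, halves and separations of subcubes *)

Definition cls (p : bool) K : {set n.-tuple bool} := [set x in K | par x == p].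

Lemma card_cls K : #|K| = #|cls false K| + #|cls true K|.
Proof.
rewrite -(cardsID [set x | ~~ par x] K); congr (_ + _); apply: eq_card => x;
  by rewrite !inE ?andbT ?negbK; case: (par x); rewrite ?andbF ?andbT.
Qed.

Definition half i (c : bool) K : {set n.-tuple bool} := [set x in K | tnth x i == c].

Lemma in_half i c K x : (x \in half i c K) = (x \in K) && (tnth x i == c).
Proof. by rewrite inE. Qed.

Lemma card_half i p K :
  #|cls p K| = #|cls p (half i false K)| + #|cls p (half i true K)|.
Proof.
rewrite -(cardsID [set x | ~~ tnth x i] (cls p K)).
by congr (_ + _); apply: eq_card => x;
  rewrite !inE ?negbK; case: (tnth x i); rewrite ?andbF ?andbT.
Qed.

(* [A] and [B] are unions of components of the subcube minus [rest D u A B]. *)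
Definition separated D u A B :=
  [/\ A \subset subcube D u, B \subset subcube D u, [disjoint A & B]
    & forall i x, x \in A -> flip i x \notin B].

Definition rest D u A B : {set n.-tuple bool} := subcube D u :\: (A :|: B).

(** The bound is the degree in the subcube: all neighbours of a vertex have the same parity, so a
    sparse set cannot contain all of them. *)
Definition sparse D K := forall p, #|cls p K| < #|D|.

Lemma separated_sym D u A B : separated D u A B -> separated D u B A.
Proof.
case=> AD BD AB h; split=> //; first by rewrite disjoint_sym.
by move=> i x xB; apply/negP=> /(h i); rewrite flipK xB.
Qed.

Lemma restC D u A B : rest D u A B = rest D u B A.
Proof. by rewrite /rest setUC. Qed.

Lemma flip_rest D u A B i x : separated D u A B ->
  i \in D -> x \in A -> flip i x \notin A -> flip i x \in rest D u A B.
Proof.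
case=> AD _ _ h iD xA fA; rewrite 2!inE (negbTE fA) (negbTE (h _ _ xA)) /=.
by rewrite flip_subcube //; apply: (subsetP AD).
Qed.

(** Otherwise all [#|D|] neighbours of [x] in the subcube lie in [rest], in a single parity class,
    against sparsity. *)
Lemma no_isolated D u A B x : separated D u A B -> sparse D (rest D u A B) ->
  x \in A -> exists2 i, i \in D & flip i x \in A.
Proof.
move=> sep sp xA; apply/exists_inP; apply: contraT.
rewrite negb_exists_in => /forall_inP h.
have := sp (~~ par x); rewrite ltnNge => /negP[].
rewrite -(card_imset (f := flip^~ x) (mem D) (@flip_inj_dir x)).
apply/subset_leq_card/subsetP=> _ /imsetP[i iD ->].
by rewrite inE par_flip eqxx andbT; apply: flip_rest => //; apply: h.
Qed.

Lemma separated_card_gt1 D u A B x : separated D u A B ->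
  sparse D (rest D u A B) -> x \in A -> 1 < #|A|.
Proof.
move=> sep sp xA; have [i iD fA] := no_isolated sep sp xA.
apply/card_gt1P; exists x, (flip i x); split=> //.
by apply/eqP=> /(congr1 par); rewrite par_flip; case: (par x).
Qed.

(** Counting: [A] and [B] have at least two vertices each and [rest] has [2 * (#|D| - 1)], which is
    more than [2 ^ #|D|] in total when [#|D|] is 1 or 2. *)
Lemma separated_dim D u A B x y : separated D u A B ->
  sparse D (rest D u A B) -> x \in A -> y \in B ->
  (forall p, #|cls p (rest D u A B)|.+1 = #|D|) -> 2 < #|D|.
Proof.
move=> sep sp xA yB e.
have A2 := separated_card_gt1 sep sp xA.
have B2 : 1 < #|B|.
  by apply: (separated_card_gt1 (separated_sym sep) _ yB); rewrite restC.
have := card_subcube D u; case: sep => AD BD AB _.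
have ABD : A :|: B \subset subcube D u by rewrite subUset AD.
rewrite -(cardsID (A :|: B)) (setIidPr ABD) -/(rest D u A B) (card_cls (rest _ _ _ _)).
have := e true; have := e false.
move: AB; rewrite -setI_eq0 => /eqP AB; rewrite cardsU AB cards0 subn0.
by case: #|D| => [|[|[|m]]] //; rewrite ?expnS ?expn0; lia.
Qed.

(** * Frozen directions and the induction over subcubes *)

Definition frozen D A : {set 'I_n} :=
  [set i in D | [forall x in A, forall y in A, tnth x i == tnth y i]].

Lemma frozenP D A i :
  reflect (i \in D /\ {in A &, forall x y, tnth x i = tnth y i}) (i \in frozen D A).
Proof.
rewrite inE; apply: (iffP andP) => [] [iD h]; split=> //.
  by move=> x y xA yA; have /forall_inP/(_ _ xA)/forall_inP/(_ _ yA)/eqP := h.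
by apply/forall_inP=> x xA; apply/forall_inP=> y yA; apply/eqP/h.
Qed.

(** Moving from a vertex of [A] in a frozen direction leaves [A], hence lands in [rest] with the
    other parity. The landing point determines the direction, as the only frozen one in which it
    differs from all of [A], and so also the starting vertex. *)
Lemma frozen_bound D u A B p : separated D u A B ->
  #|cls p A| * #|frozen D A| <= #|cls (~~ p) (rest D u A B)|.
Proof.
move=> sep; rewrite -cardsX.
rewrite -(card_in_imset (f := fun q => flip q.2 q.1)).
  apply/subset_leq_card/subsetP=> _ /imsetP[[x i] /setXP /= [xA /frozenP[iD h]] ->].
  move: xA; rewrite inE => /andP[xA /eqP px].
  rewrite inE par_flip px eqxx andbT; apply: flip_rest => //; apply/negP=> fA.
  by have := h _ _ xA fA; rewrite tnth_flip eqxx; case: (tnth x i).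
move=> [x i] [y j] /setXP /= [xA /frozenP[iD h]] /setXP /= [yA _] E.
have ij : i = j.
  move: xA yA; rewrite !inE => /andP[xA _] /andP[yA _].
  have := congr1 (fun z => tnth z i) E; rewrite /= !tnth_flip eqxx (h _ _ xA yA).
  by move/addbI/esym/eqP.
by rewrite ij in E *; rewrite (inv_inj (@flipK j) E).
Qed.

(* Adjacent vertices have opposite parities, so the second clause says that every
   edge inside [K] has direction [i]. *)
Definition parity_locked D K :=
  (forall p, #|cls p K|.+1 = #|D|)
  /\ exists i, exists b, {in K, forall y, tnth y i = b (+) par y}.

(* If [A] has at most one vertex of each parity, then [A] is an edge. *)
Lemma edge_locked D u A B x : separated D u A B -> sparse D (rest D u A B) ->
  x \in A -> (forall p, #|cls p A| <= 1) -> parity_locked D (rest D u A B).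
Proof.
move=> sep sp xA A1; have [i iD fA] := no_isolated sep sp xA.
(* [z p] is the endpoint of parity [p] of the edge between [x] and [flip i x]. *)
pose z p := if par x == p then x else flip i x.
have zA p : z p \in A by rewrite /z; case: ifP.
have parz p : par (z p) = p.
  by rewrite /z; case: eqP => // /eqP; rewrite par_flip; case: (par x) p => [] [].
have zi p : tnth (z p) i = tnth x i (+) (par x (+) p).
  rewrite /z; case: eqP => [<-|/eqP]; first by rewrite addbb addbF.
  by rewrite tnth_flip eqxx; case: (par x) p => [] [].
(* The neighbours of [z p] in directions other than [i] are outside [A], since [A] has no second
   vertex of their parity. They number [#|D| - 1], which sparsity makes the whole class. *)
have clsE p : cls (~~ p) (rest D u A B) = [set flip j (z p) | j in D :\ i].
  apply/esym/eqP; rewrite eqEcard; apply/andP; split.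
    apply/subsetP=> _ /imsetP[j /setD1P[ji jD] ->].
    rewrite inE par_flip parz eqxx andbT; apply: flip_rest => //.
    apply: contra ji => jA; apply/eqP/(@flip_inj_dir (z p)).
    have /card_le1_eqP := A1 (~~ p); apply; rewrite !inE ?par_flip ?parz ?eqxx ?jA //.
    by rewrite /z; case: ifP; rewrite ?fA ?flipK ?xA.
  rewrite card_imset; last exact: flip_inj_dir.
  by have := sp (~~ p); rewrite (cardsD1 i D) iD.
split=> [p|].
  by rewrite -[p]negbK clsE card_imset ?(cardsD1 i D) ?iD //; exact: flip_inj_dir.
exists i, (~~ (tnth x i (+) par x)) => y yK.
have : y \in cls (~~ ~~ par y) (rest D u A B) by rewrite inE yK negbK eqxx.
rewrite clsE => /imsetP[j /setD1P[ji _] {1}->].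
rewrite tnth_flip eq_sym (negbTE ji) zi.
by case: (tnth x i) (par x) (par y) => [] [] [].
Qed.

Lemma subcube_half D u i c x : i \in D -> x \in half i c (subcube D u) ->
  half i c (subcube D u) = subcube (D :\ i) x.
Proof.
move=> iD /setIdP[/subcubeP xD /eqP xi]; apply/setP=> y.
apply/setIdP/subcubeP => [[/subcubeP yD /eqP yi] j|h].
  by rewrite !inE negb_and negbK => /orP[/eqP->|jD]; rewrite ?yi ?xi ?yD ?xD.
split; last by rewrite h ?xi // !inE eqxx.
by apply/subcubeP=> j jD; rewrite h ?xD // !inE (negbTE jD) andbF.
Qed.

(** This is what lets the induction restrict a separation to a facet of the subcube. *)
Lemma separated_half D u A B i c x : separated D u A B -> i \in D ->
  x \in half i c (subcube D u) ->
  separated (D :\ i) x (half i c A) (half i c B)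
  /\ half i c (rest D u A B) = rest (D :\ i) x (half i c A) (half i c B).
Proof.
move=> [AD BD AB h] iD xD; rewrite /separated /rest -(subcube_half iD xD); split; last first.
  by apply/setP=> y; rewrite !inE; case: (tnth y i == c); rewrite ?andbF ?andbT.
split.
- by apply/subsetP=> y /setIdP[/(subsetP AD) yA yi]; rewrite in_half yA.
- by apply/subsetP=> y /setIdP[/(subsetP BD) yA yi]; rewrite in_half yA.
- apply/pred0P=> y /=; rewrite !inE; have /pred0P/(_ y)/= := AB.
  by case: (y \in A); case: (y \in B); rewrite ?andbF.
by move=> j y /setIdP[yA _]; rewrite inE (negbTE (h j y yA)).
Qed.

Lemma balanced_cut D u A B x y : separated D u A B ->
  sparse D (rest D u A B) -> x \in A -> y \in B ->
  2 < #|D| /\ parity_locked D (rest D u A B).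
Proof.
have [m] := ubnP #|D|; elim: m D u A B x y => // m IH D u A B x y.
rewrite ltnS => leDm sep sp xA yB.
suff lk : parity_locked D (rest D u A B).
  by split=> //; apply: (separated_dim sep sp xA yB); case: lk.
have D0 : 0 < #|D| by apply: leq_ltn_trans (sp true).
(* If many directions are frozen, one of the two sets has at least [#|D| / 2] of them, so
   [frozen_bound] leaves it at most one vertex of each parity. *)
have [le_fr | lt_fr] := leqP #|D| (#|frozen D A| + #|frozen D B|).
  have small E p : #|D| <= 2 * #|frozen D E| ->
      #|cls p E| * #|frozen D E| < #|D| -> #|cls p E| <= 1.
    by case: #|cls p E| => [|[|c]] // h1 h2; nia.
  have [le_AB|/ltnW le_BA] := leqP #|frozen D B| #|frozen D A|.
    apply: edge_locked xA _ => // p; apply: small; first by lia.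
    exact: leq_ltn_trans (frozen_bound p sep) (sp _).
  have sep' := separated_sym sep; rewrite restC in sp *.
  apply: edge_locked yB _ => // p; apply: small; first by lia.
  exact: leq_ltn_trans (frozen_bound p sep') (sp _).
(* Otherwise some direction is frozen for neither set, so both halves along it meet both [A] and [B]
   and inherit a separation. *)
have [i iD iNf] : exists2 i, i \in D & i \notin frozen D A :|: frozen D B.
  apply/subsetPn; apply/negP=> /subset_leq_card.
  by rewrite leqNgt (leq_ltn_trans _ lt_fr) // cardsU leq_subr.
have half_nonempty E c : i \notin frozen D E -> exists z, z \in half i c E.
  rewrite inE iD /= negb_forall_in => /exists_inP[a aE].
  rewrite negb_forall_in => /exists_inP[b bE ab].
  have [ai|ai] := eqVneq (tnth a i) c; first by exists a; rewrite inE aE ai eqxx.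
  exists b; rewrite inE bE /=.
  by case: (tnth a i) (tnth b i) c ab ai => [] [] [].
move: iNf; rewrite inE negb_or => /andP[iA iB].
case: (sep) => AD BD AB _; set K := rest D u A B in sp *.
have Di : #|D| = #|D :\ i|.+1 by rewrite (cardsD1 i) iD.
have IHc c : sparse (D :\ i) (half i c K) ->
    2 < #|D :\ i| /\ forall p, #|cls p (half i c K)|.+1 = #|D :\ i|.
  have [a aA] := half_nonempty A c iA; have [b bB] := half_nonempty B c iB.
  have aD : a \in half i c (subcube D u).
    by move: aA; rewrite !in_half => /andP[/(subsetP AD) ->].
  have [sepc ->] := separated_half sep iD aD => spc.
  have ltDm : #|D :\ i| < m by rewrite -Di.
  by have [? []] := IH _ _ _ _ _ _ ltDm sepc spc aA bB.
(* If [i] were the only direction, a half would be a single vertex, common to [A] and [B]. *)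
have Dgt0 : 0 < #|D :\ i|.
  have [a aA] := half_nonempty A false iA; have [b bB] := half_nonempty B false iB.
  rewrite lt0n cards_eq0; apply/eqP=> D0'.
  have aD : a \in half i false (subcube D u).
    by move: aA; rewrite !in_half => /andP[/(subsetP AD) ->].
  have : b \in half i false (subcube D u).
    by move: bB; rewrite !in_half => /andP[/(subsetP BD) ->].
  rewrite (subcube_half iD aD) D0' => /subcubeP ba.
  have {}ba : b = a by apply: eq_from_tnth => j; rewrite ba // inE.
  have /pred0P/(_ a)/= := AB; move: aA bB; rewrite ba !inE.
  by move=> /andP[-> _] /andP[-> _].
clearbody K.
have sp' p : #|cls p K| <= #|D :\ i| by have := sp p; rewrite Di ltnS.
have sum p : #|cls p K| = #|cls p (half i false K)| + #|cls p (half i true K)|.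
  exact: card_half.
(* Each half contains an entire parity class of [K], of size [#|D| - 1], and the two halves contain
   opposite classes. *)
have [q hq] : exists q, forall c, #|D :\ i| <= #|cls (q (+) c) (half i c K)|.
  (* If half [c] were sparse, induction would give it [#|D| - 2] vertices of each parity, leaving at
     most one of each for the other half. That half would then be sparse too, and induction would
     give it [#|D| - 2 > 1] of each. *)
  have full c : exists p, #|D :\ i| <= #|cls p (half i c K)|.
    apply/existsP; apply: contraT; rewrite negb_exists => /forallP h.
    have spc : sparse (D :\ i) (half i c K) by move=> p; rewrite ltnNge.
    have [D3 e] := IHc c spc.
    have spc' p : #|cls p (half i (~~ c) K)| < #|D :\ i|.
      by move: D3 (sum p) (sp' p) (e p); case: c {h spc e} => /=; clear; lia.
    have [_ e'] := IHc _ spc'.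
    move: D3 (sum true) (sp' true) (e true) (e' true).
    by case: c {h spc e spc' e'} => /=; clear; lia.
  have [p0 h0] := full false; have [p1 h1] := full true.
  (* Equal parities would give [K] at least [2 * (#|D| - 1)] vertices of that parity, beyond its
     bound [#|D| - 1]. *)
  have p10 : p1 = ~~ p0.
    apply/eqP; apply: contraT => ne; have E : p1 = p0.
      by move: ne; clear; case: p0 p1 => [] [].
    rewrite {}E in h1 ne *.
    by move: (sum p0) (sp' p0) Dgt0 h0 h1; clear; lia.
  by exists p0 => -[]; rewrite ?addbT ?addbF -?p10.
have hle c p : #|cls p (half i c K)| + #|cls p (half i (~~ c) K)| <= #|D :\ i|.
  by rewrite (leq_trans _ (sp' p)) // sum; case: c => //; rewrite addnC.
split=> [p|].
  rewrite Di; congr _.+1; have := hq (q (+) p); rewrite addKb.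
  by move: (sum p) (sp' p); case: (q (+) p) => /=; clear; lia.
(* As half [c] holds all vertices of parity [q (+) c], the parity of a vertex of [K] determines its
   coordinate [i]. *)
exists i, q => z zK; apply/eqP; apply: contraT; set c := tnth z i => ne.
have E : par z = q (+) ~~ c by move: ne; clear; case: c q (par z) => [] [] [].
have := hq (~~ c); have := hle (~~ c) (q (+) ~~ c); rewrite negbK.
have : 0 < #|cls (q (+) ~~ c) (half i c K)|.
  by apply/card_gt0P; exists z; rewrite !inE zK E !eqxx.
by clear; lia.
Qed.
End Flip.

(** * Graphs and subgraphs *)

Lemma min_card_le (T : finType) (P : pred {set T}) F : P F -> min_card P <= #|F|.
Proof.
rewrite /min_card => PF; case: pickP => [F0 PF0|/(_ F)]; last by rewrite PF.
by case: arg_minnP => // F1 _; apply.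
Qed.

(** The witness [F0] excludes the default value 0 of [min_card]. *)
Lemma min_card_ge (T : finType) (P : pred {set T}) m F0 : P F0 ->
  (forall F, P F -> m <= #|F|) -> m <= min_card P.
Proof.
rewrite /min_card => PF0 h; case: pickP => [F1 PF1|/(_ F0)]; last by rewrite PF0.
by case: arg_minnP => // F2 /h.
Qed.

Lemma set2_eq (T : finType) (x y a b : T) :
  [set x; y] = [set a; b] -> x = a /\ y = b \/ x = b /\ y = a.
Proof.
move=> E; have /set2P X : x \in [set a; b] by rewrite -E set21.
have /set2P Y : y \in [set a; b] by rewrite -E set22.
have /set2P A : a \in [set x; y] by rewrite E set21.
have /set2P B : b \in [set x; y] by rewrite E set22.
by intuition congruence.
Qed.

Section Graphs.
Implicit Types G H : sgraph.

Lemma isomorphicP G H : reflect (exists2 f : G -> H, bijective f &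
  forall x y, adj (f x) (f y) = adj x y) (isomorphic G H).
Proof.
apply: (iffP existsP) => [[f /existsP[g /and3P[/forallP fg /forallP gf /forallP h]]]|].
  exists f; first by exists g => x; apply/eqP.
  by move=> x y; have /forallP/(_ y)/eqP := h x.
case=> f [g fg gf] h; exists (finfun f); apply/existsP; exists (finfun g).
apply/and3P; split; apply/forallP=> x; rewrite ?ffunE ?fg ?gf //.
by apply/forallP=> y; rewrite !ffunE h.
Qed.

Lemma isomorphic_sym G H : isomorphic G H -> isomorphic H G.
Proof.
move=> /isomorphicP[f [g fg gf] h]; apply/isomorphicP; exists g; first by exists f.
by move=> x y; rewrite -h !gf.
Qed.

Lemma isomorphic_trans G H I :
  isomorphic G H -> isomorphic H I -> isomorphic G I.
Proof.
move=> /isomorphicP[f bf hf] /isomorphicP[g bg hg]; apply/isomorphicP.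
by exists (g \o f) => [|x y]; [apply: bij_comp | rewrite /= hg hf].
Qed.

(** Connectedness is exploited through invariants: the bounds on members of a cut come from
    functions that are constant along edges. *)
Lemma connected_eq (X : eqType) G (h : G -> X) : connected G ->
  (forall x y, adj x y -> h x = h y) -> forall x y, h x = h y.
Proof.
move=> /andP[_ /forallP c] hh x y; have /forallP/(_ y)/connectP[p] := c x.
by elim: p x => [|z p IH] x /=; [move=> _ -> | move=> /andP[/hh-> /IH]; apply].
Qed.

Lemma isomorphic_connected G H : isomorphic G H -> connected H -> connected G.
Proof.
move=> /isomorphicP[f [g fg gf] h] /andP[H0 /forallP c]; apply/andP; split.
  by case/card_gt0P: H0 => y _; apply/card_gt0P; exists (g y).
have gc a b : connect (@adj H) a b -> connect (@adj G) (g a) (g b).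
  case/connectP=> p; elim: p a => [|z p IH] a /=; first by move=> _ ->.
  move=> /andP[az /IH{}IH] /IH; apply: connect_trans; apply: connect1.
  by rewrite -h !gf.
apply/forallP=> x; apply/forallP=> y; rewrite -[x]fg -[y]fg; apply: gc.
exact/forallP/c.
Qed.

Lemma edgesP G (S : subgraph G) e : e \in edges S ->
  exists x y, [/\ x \in verts S, y \in verts S, adj x y & e = [set x; y]].
Proof.
move=> eS; have /forall_inP/(_ _ eS) := valP S.
move=> /exists_inP[x xS /exists_inP[y yS /andP[xy /eqP->]]].
by exists x, y.
Qed.

Lemma edges_adj G (S : subgraph G) x y : [set x; y] \in edges S ->
  [/\ x \in verts S, y \in verts S & adj x y].
Proof.
move=> /edgesP[a [b [aS bS ab /set2_eq[[-> ->]|[-> ->]]]]] //.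
by rewrite adj_sym.
Qed.

(** Only edges of [T] have to map to edges: subgraphs are not induced, so further adjacencies
    between image points are harmless. *)
Lemma image_subgraph G H (T : subgraph H) (f : H -> G) :
  {in verts T &, injective f} ->
  (forall x y, [set x; y] \in edges T -> adj (f x) (f y)) ->
  exists2 S : subgraph G, verts S = f @: verts T &
    isomorphic (graph_of_subgraph S) (graph_of_subgraph T).
Proof.
move=> finj fadj.
have sub : is_subgraph (f @: verts T, [set f @: e | e : {set H} in edges T]).
  apply/forall_inP=> _ /imsetP[e eT ->]; have [x [y [xT yT _ E]]] := edgesP eT.
  apply/exists_inP; exists (f x); first exact: imset_f.
  apply/exists_inP; exists (f y); first exact: imset_f.
  by rewrite E imsetU1 imset_set1 eqxx fadj // -E.
pose S : subgraph G := exist (@is_subgraph G) _ sub.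
exists S => //; apply: isomorphic_sym; apply/isomorphicP.
have fS (x : graph_of_subgraph T) : f (val x) \in verts S.
  by apply: imset_f; apply: valP.
exists (fun x => exist (fun y => y \in verts S) _ (fS x) : graph_of_subgraph S).
  apply: inj_card_bij => [x y /(congr1 val) /= E|].
    by apply/val_inj/finj; rewrite ?E //; apply: valP.
  by rewrite !card_sig !(eq_card (B := mem (verts _)) (fun=> erefl _)) card_in_imset.
move=> x y; rewrite /= /sub_adj /=; apply/imsetP/idP => [[e eT]|xy].
  have [a [b [aT bT _ E]]] := edgesP eT.
  rewrite E imsetU1 imset_set1 => /set2_eq.
  have xT : val x \in verts T := valP x; have yT : val y \in verts T := valP y.
  case=> -[/(finj _ _ xT) -> // /(finj _ _ yT) -> //]; first by rewrite -E.
  by rewrite setUC -E.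
by exists [set val x; val y]; rewrite // imsetU1 imset_set1.
Qed.

Lemma full_subgraph H : exists2 T : subgraph H, verts T = setT &
  isomorphic (graph_of_subgraph T) H /\ forall x y, [set x; y] \in edges T -> adj x y.
Proof.
have sub : is_subgraph ([set: H],
    [set [set p.1; p.2] | p : H * H in [pred p | adj p.1 p.2]]).
  apply/forall_inP=> _ /imsetP[[x y] xy ->].
  apply/exists_inP; exists x => //; apply/exists_inP; exists y => //.
  by rewrite eqxx andbT.
exists (exist (@is_subgraph H) _ sub) => //; split; last by move=> x y /edges_adj[].
apply/isomorphicP; exists val.
  apply: inj_card_bij val_inj _.
  by rewrite card_sig !(eq_card (B := mem setT) (fun=> erefl _)) cardsT.
move=> x y; rewrite /= /sub_adj /=; apply/idP/imsetP => [xy|[[a b] /= ab]].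
  by exists (val x, val y).
by move=> /set2_eq[] [-> ->] //; rewrite adj_sym.
Qed.

(** The vertex [v] survives without neighbours: either it is alone, or it is not connected to any
    other survivor. *)
Lemma isolating_cut G (A : {set G}) v : v \notin A ->
  (forall y, adj v y -> y \in A) ->
  disconnected (delete_vertices A) || trivial_graph (delete_vertices A).
Proof.
move=> vA nb; pose v' : delete_vertices A := exist (fun y => y \notin A) v vA.
apply/orP; have [|c1] := boolP (trivial_graph (delete_vertices A)); [by right|left].
have [y yv] : exists y, y != v'.
  apply/existsP; apply: contraR c1; rewrite negb_exists => /forallP h.
  rewrite /trivial_graph -cardsT; apply/cards1P; exists v'; apply/setP=> y.
  by rewrite !inE; have := h y; rewrite negbK => ->.
apply/existsP; exists v'; apply/existsP; exists y.
apply: contra yv => /connectP[[|z p] /=]; first by move=> _ ->.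
by move=> /andP[/nb]; rewrite (negbTE (valP z)).
Qed.

End Graphs.

(** * Subgraphs of a cycle *)

Section Cycles.
Variable k : nat.

Lemma cycle_connected : 0 < k -> connected (cycle_graph k).
Proof.
move=> k0; apply/andP; split; first by rewrite card_ord.
have c0 (i : 'I_k) : connect (@adj (cycle_graph k)) (Ordinal k0) i.
  case: i; elim=> [|i IH] ik; first by rewrite (bool_irrelevance ik k0) connect0.
  apply: connect_trans (IH (ltnW ik)) _; apply: connect1; apply/andP; split.
    by rewrite -val_eqE /= neq_ltn ltnSn.
  by rewrite -val_eqE /= modn_small ?eqxx.
apply/forallP=> i; apply/forallP=> j; apply: connect_trans (c0 j).
by rewrite (sym_connect_sym (@adj_sym _)).
Qed.

Lemma odd_ordS (i : 'I_k) : ~~ odd k -> odd (ordS i) = ~~ odd i.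
Proof.
(* The wrap-around from [k - 1] to 0 also changes parity, because [k] is even. *)
move=> ek /=; have := ltn_ord i; rewrite leq_eqVlt => /orP[/eqP E|ik].
  by rewrite E modnn; move: ek; rewrite -{1}E /= => /negbTE ->.
by rewrite modn_small.
Qed.

(** The successor map [ordS] is injective and exchanges the two classes, so they have equal size. *)
Lemma card_ord_odd r : ~~ odd k -> #|[set i : 'I_k | odd i == r]| = k./2.
Proof.
move=> ek; pose P b := [set i : 'I_k | odd i == b].
have le b : #|P b| <= #|P (~~ b)|.
  rewrite -(card_imset (P b) (@ordS_inj k)); apply/subset_leq_card/subsetP.
  by move=> _ /imsetP[i + ->]; rewrite !inE odd_ordS // => /eqP->.
have tot : #|P r| + #|P (~~ r)| = k.
  rewrite -[RHS](card_ord k) -cardsT -(cardsID (P r) setT) setTI; congr (_ + _).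
  by apply: eq_card => i; rewrite !inE; case: (odd i) r => [] [].
have := le r; have := le (~~ r); rewrite negbK; rewrite -/(P r).
by move: tot ek; clear; lia.
Qed.

Lemma odd_adj (i j : cycle_graph k) : ~~ odd k -> adj i j -> odd j = ~~ odd i.
Proof.
move=> ek /andP[_ /orP[]] /eqP->; first exact: odd_ordS.
by rewrite odd_ordS ?negbK.
Qed.

(** The closing edge of the cycle is left out even for [l = k], so that a mere path in another graph
    can be matched with this subgraph. *)
Lemma segment_subgraph l : 0 < l <= k ->
  exists2 T : subgraph (cycle_graph k), verts T = [set i : 'I_k | i < l] &
    connected (graph_of_subgraph T)
    /\ forall x y : 'I_k, [set x; y] \in edges T -> y = x.+1 :> nat \/ x = y.+1 :> nat.
Proof.
move=> /andP[l0 lk].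
pose E := [set [set p.1; p.2] | p : 'I_k * 'I_k in
  [pred p : 'I_k * 'I_k | (p.2 == p.1.+1 :> nat) && (p.2 < l)]].
have sub : @is_subgraph (cycle_graph k) ([set i : 'I_k | i < l], E).
  apply/forall_inP=> _ /imsetP[[x y] /= /andP[/eqP xy yl] ->].
  apply/exists_inP; exists x; first by rewrite inE -xy ltnW.
  apply/exists_inP; exists y; first by rewrite inE.
  rewrite eqxx andbT /cycle_adj -!val_eqE /= -xy modn_small ?eqxx ?andbT //.
  by rewrite xy neq_ltn ltnSn.
pose T : subgraph (cycle_graph k) := exist (@is_subgraph (cycle_graph k)) _ sub.
exists T => //; split; last first.
  move=> x y /imsetP[[a b] /= /andP[/eqP ab _]] /set2_eq[] [-> ->]; first by left.
  by right.
have ordT i (il : i < l) : Ordinal (leq_trans il lk) \in verts T by rewrite inE.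
pose v i (il : i < l) : graph_of_subgraph T :=
  exist (fun y => y \in verts T) _ (ordT i il).
have vP (x : graph_of_subgraph T) : exists i, exists il, x = v i il.
  have xT : val x \in verts T := valP x; rewrite inE in xT.
  by exists (val x), xT; apply/val_inj/val_inj.
apply/andP; split; first by apply/card_gt0P; exists (v 0 l0).
have c0 i il : connect (@adj (graph_of_subgraph T)) (v 0 l0) (v i il).
  elim: i il => [|i IH] il; first by rewrite (bool_irrelevance il l0) connect0.
  apply: connect_trans (IH (ltnW il)) _; apply: connect1.
  rewrite /= /sub_adj /=; apply/imsetP.
  by exists (val (v i (ltnW il)), val (v i.+1 il)); rewrite ?inE //= eqxx il.
apply/forallP=> x; apply/forallP=> y; have [j [jl ->]] := vP y.
apply: connect_trans (c0 j jl); have [i [il ->]] := vP x.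
by rewrite (sym_connect_sym (@adj_sym _)).
Qed.

Lemma path_subgraph (G : sgraph) (x : G) p :
  path (@adj G) x p -> uniq (x :: p) -> size p < k ->
  exists2 S : subgraph G, verts S = [set y in x :: p] &
    [exists T : subgraph (cycle_graph k), connected (graph_of_subgraph T)
       && isomorphic (graph_of_subgraph S) (graph_of_subgraph T)].
Proof.
move=> /(pathP x) px un sk.
have [|T vT [cT eT]] := @segment_subgraph (size p).+1; first by rewrite sk.
have Tsz i : i \in verts T -> i < size (x :: p) by rewrite vT inE.
have [|i j ij|S vS iS] := @image_subgraph G _ T (fun i : 'I_k => nth x (x :: p) i).
- move=> i j /Tsz iT /Tsz jT /eqP; rewrite nth_uniq // => /eqP ij.
  exact: val_inj.
- have [iT jT _] := edges_adj ij; move: (Tsz i iT) (Tsz j jT) => {}iT {}jT.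
  case: (eT i j ij) => E; rewrite E in iT jT *; first exact: px.
  by rewrite adj_sym; apply: px.
exists S; last by apply/existsP; exists T; rewrite cT.
rewrite vS; apply/setP=> y; rewrite !inE -in_cons; apply/imsetP/idP => [[i iT ->]|].
  by apply: mem_nth; apply: Tsz.
rewrite -index_mem => yp; have yi := leq_trans yp sk.
exists (Ordinal yi); last by rewrite nth_index // -index_mem.
by rewrite vT inE.
Qed.

Lemma cycle_subgraph (G : sgraph) (x : G) p :
  cycle (@adj G) (x :: p) -> uniq (x :: p) -> (size p).+1 = k ->
  exists2 S : subgraph G, verts S = [set y in x :: p] &
    isomorphic (graph_of_subgraph S) (cycle_graph k).
Proof.
move=> /(pathP x) px un sk; rewrite size_rcons in px.
have [T vT [iT eT]] := full_subgraph (cycle_graph k).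
(* At the last index [ordS] returns to 0, and the required adjacency is the closing edge of the
   cycle. *)
have step (i : 'I_k) : adj (nth x (x :: p) i) (nth x (x :: p) (ordS i)).
  have ik : i < (size p).+1 by rewrite sk.
  have := px i ik; rewrite -rcons_cons !nth_rcons /= ik.
  move: ik; rewrite ltnS leq_eqVlt => /orP[/eqP ip|ip].
    by rewrite ip ltnn eqxx sk modnn.
  by rewrite ip modn_small // (leq_trans _ (eq_leq sk)).
have [|i j ij|S vS iS] := @image_subgraph G _ T (fun i : 'I_k => nth x (x :: p) i).
- by move=> i j _ _ /eqP; rewrite nth_uniq ?[size _]sk // => /eqP/val_inj.
- by have /andP[_ /orP[]/eqP->] := eT _ _ ij; rewrite // adj_sym.
exists S; last exact: isomorphic_trans iT.
rewrite vS vT; apply/setP=> y; rewrite !inE -in_cons; apply/imsetP/idP => [[i _ ->]|].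
  by apply: mem_nth; rewrite [size _]sk.
rewrite -index_mem => yp; have yi := leq_trans yp (eq_leq sk).
by exists (Ordinal yi); rewrite ?inE // nth_index // -index_mem.
Qed.

End Cycles.

(** * Structure cuts of the hypercube *)

Section Cube.
Variable n : nat.
Implicit Types (i j : 'I_n) (x y u v : n.-tuple bool).

Notation Q := (hypercube n).

Lemma hypercube_adjP (x y : Q) : reflect (exists i, y = flip i x) (adj x y).
Proof. exact: cube_adjP. Qed.

Lemma adj_par (x y : Q) : adj x y -> par y = ~~ par x.
Proof. by case/hypercube_adjP=> i ->; rewrite par_flip. Qed.

(** * Parity classes of a member of a cut *)

Section Members.
Variables (k : nat) (S : subgraph Q) (T : subgraph (cycle_graph k)).
Hypotheses (cT : connected (graph_of_subgraph T))
  (iST : isomorphic (graph_of_subgraph S) (graph_of_subgraph T)).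

Let cS : connected (graph_of_subgraph S) := isomorphic_connected iST cT.

(* Along the edges of [S], the parity in the cube and the parity of the
   position on the cycle change together. *)
Lemma card_cls_member p : ~~ odd k -> #|cls p (verts S)| <= k./2.
Proof.
move=> ek; have /isomorphicP[f [g fg gf] h] := iST.
pose c (x : graph_of_subgraph S) := par (val x) (+) odd (val (f x) : 'I_k).
have cc : forall z t, c z = c t.
  apply: (connected_eq cS) => x y xy; rewrite /c.
  have /edges_adj[_ _ /adj_par ->] := xy.
  rewrite -h in xy; have /edges_adj[_ _ /odd_adj ->//] := xy.
  by case: (par _) (odd _) => [] [].
have [->|[x0 x0S]] := set_0Vmem (verts S).
  by rewrite (_ : cls p set0 = set0) ?cards0 //; apply/setP=> x; rewrite !inE.
pose y0 : graph_of_subgraph S := exist (fun x => x \in verts S) x0 x0S.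
pose b := c y0.
rewrite -(card_ord_odd (b (+) p) ek).
(* [F] extends [f] to all vertices of the cube by an arbitrary value; on [verts S] it injects parity
   [p] into positions of parity [b (+) p]. *)
pose F x : 'I_k := if insub x is Some x' then val (f x') else val (f y0).
have FE x (xS : x \in verts S) : F x = val (f (exist (fun x => x \in verts S) x xS)).
  by rewrite /F insubT.
rewrite -(card_in_imset (f := F)).
  apply/subset_leq_card/subsetP=> _ /imsetP[x + ->]; rewrite !inE => /andP[xS /eqP px].
  by rewrite (FE x xS) /b (cc _ (exist _ x xS)) /c /= px -addbA addbC addbK.
move=> x y; rewrite !inE => /andP[xS _] /andP[yS _].
by rewrite (FE x xS) (FE y yS) => /val_inj/(can_inj fg)/(congr1 val).
Qed.

(** Every edge of [S] has direction [i], so the map [h] folding such edges onto their even endpoint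
    is constant on [S]. Hence [S] lies within one edge of the cube. *)
Lemma card_cls_locked p i b : {in verts S, forall y, tnth y i = b (+) par y} ->
  #|cls p (verts S)| <= 1.
Proof.
move=> lk; apply/card_le1_eqP => x y; rewrite !inE.
move=> /andP[xS /eqP px] /andP[yS /eqP py].
pose h (z : graph_of_subgraph S) := if par (val z) then flip i (val z) else val z.
have hh : forall z t, h z = h t.
  apply: (connected_eq cS) => z t zt; rewrite /h.
  have /edges_adj[zS tS /hypercube_adjP[j jP]] := zt.
  have := lk _ tS; rewrite jP tnth_flip par_flip (lk _ zS) => E.
  have -> : j = i.
    by apply/eqP; rewrite eq_sym; move: E; clear; case: (i == j) b (par _) => [] [] [].
  by rewrite flipK; case: (par _).
have := hh (exist _ x xS) (exist _ y yS); rewrite /h /= px py.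
by case: (p) => // /(inv_inj (@flipK _ i)).
Qed.

End Members.

Lemma card_cls_cover p (F : {set subgraph Q}) m :
  (forall S, S \in F -> #|cls p (verts S)| <= m) ->
  #|cls p (cover_verts F)| <= #|F| * m.
Proof.
move=> h; rewrite -sum_nat_const.
apply: (@leq_trans (\sum_(S in F) #|cls p (verts S)|)); last exact: leq_sum.
rewrite /cover_verts; elim/big_rec2: _ => [|S c A _ IH].
  by rewrite (_ : cls p set0 = set0) ?cards0 //; apply/setP=> x; rewrite !inE.
rewrite (_ : cls p (_ :|: A) = cls p (verts S) :|: cls p A).
  by rewrite (leq_trans (leq_card_setU _ _)) ?leq_add2l.
by apply/setP=> x; rewrite !inE andb_orl.
Qed.

Lemma card_cls_neighbours (A : {set n.-tuple bool}) x :
  (forall i, flip i x \in A) -> n <= #|cls (~~ par x) A|.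
Proof.
move=> h; rewrite -[X in X <= _](card_ord n) -cardsT -(card_imset _ (@flip_inj_dir n x)).
apply/subset_leq_card/subsetP=> _ /imsetP[i _ ->].
by rewrite inE h par_flip eqxx.
Qed.

Lemma disconnected_parity_locked (A : {set Q}) :
  disconnected (delete_vertices A) -> (forall p, #|cls p A| < n) ->
  2 < n /\ parity_locked [set: 'I_n] A.
Proof.
case/existsP=> x /existsP[y xy] sp.
pose V := delete_vertices A.
(* [X] is the component of [x] and [Y] consists of all other survivors; they are separated in the
   full cube and [A] is the rest. *)
pose X : {set Q} := [set val z | z : V in connect (@adj V) x].
pose Y : {set Q} := ~: (X :|: A).
have XA z : z \in X -> z \notin A by case/imsetP=> t _ ->; exact: (valP t).
have xX : val x \in X by apply: imset_f; rewrite inE connect0.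
have yY : val y \in Y.
  rewrite !inE negb_or (valP y) andbT; apply/imsetP=> -[z + /val_inj E].
  by rewrite inE -E (negbTE xy).
have full z : z \in subcube setT (val x) by apply/subcubeP=> i; rewrite inE.
have sep : separated setT (val x) X Y.
  split; [exact/subsetP | exact/subsetP | |].
    by rewrite -setI_eq0; apply/eqP/setP=> z; rewrite !inE; case: (z \in X).
  move=> i z zX; rewrite !inE negbK -implyNb; apply/implyP/contraNT.
  move: zX => /imsetP[t xt ->] ft; apply/imsetP.
  pose t' : V := exist (fun z => z \notin A) _ ft; exists t' => //.
  rewrite !inE in xt *; apply: connect_trans xt _; apply: connect1.
  exact: cube_adj_flip.
have restE : rest setT (val x) X Y = A.
  apply/setP=> z; rewrite inE full andbT !inE.
  by have := XA z; case: (z \in X) => [/(_ isT)/negbTE->|_]; rewrite // negbK.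
have := balanced_cut sep _ xX yY; rewrite restE cardsT card_ord; apply.
by move=> p; rewrite cardsT card_ord.
Qed.

Lemma substructure_cut_bound k (F : {set subgraph Q}) : 2 < k -> ~~ odd k -> 1 < n ->
  substructure_cut (cycle_graph k) F -> 2 * n <= k * #|F|.
Proof.
move=> k3 ek n2 /andP[/forall_inP mem sep]; rewrite leqNgt; apply/negP=> lt.
pose K := cover_verts F.
have sp p : #|cls p K| < n.
  apply: (@leq_ltn_trans (#|F| * k./2)).
    by apply: card_cls_cover => S /mem/existsP[T /andP[cT iT]]; apply: card_cls_member iT _ ek.
  by move: lt; rewrite -{1}(even_halfK ek) -doubleMl mul2n ltn_double mulnC.
case/orP: sep => [disc | triv].
  have [n3 [e [i [b lk]]]] := disconnected_parity_locked disc sp.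
  have : #|cls true K| <= #|F| * 1.
    apply: card_cls_cover => S SF; have /existsP[T /andP[cT iT]] := mem S SF.
    apply: (@card_cls_locked _ _ _ cT iT true i b) => y yS; apply: lk.
    by apply/bigcupP; exists S.
  have := e true; rewrite cardsT card_ord -/K muln1.
  have k4 : 3 < k by move: k3 ek; clear; case: k => [|[|[|[|]]]].
  (* With [n - 1 <= #|F|], one gets [4 * (n - 1) <= k * #|F| < 2 * n], impossible for [n > 2]. *)
  move: #|F| #|_| lt k4 n3; clear => f c; nia.
(* If a single vertex survives, its [n] neighbours are all deleted and have the same parity, again
   too many. *)
move: triv; rewrite /trivial_graph -cardsT => /cards1P[x xP].
have : n <= #|cls (~~ par (val x)) K|.
  apply: card_cls_neighbours => i; apply: contraT => fK.
  have : exist (fun z => z \notin K) _ fK \in [set x] by rewrite -xP inE.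
  rewrite inE => /eqP/(congr1 val)/= /(congr1 (@par n)).
  by rewrite par_flip; case: (par _).
by rewrite leqNgt sp.
Qed.

(** * Paths through the neighbours of the origin *)

Definition origin : n.-tuple bool := [tuple false | _ < n].

Lemma tnth_unit i j : tnth (flip i origin) j = (j == i).
Proof. by rewrite tnth_flip tnth_mktuple. Qed.

Lemma covering_separates (F : {set subgraph Q}) :
  (forall S, S \in F -> origin \notin verts S) ->
  (forall i, exists2 S, S \in F & flip i origin \in verts S) -> separates F.
Proof.
move=> h0 h; apply: (@isolating_cut Q _ origin).
  by apply/bigcupP=> -[S /h0/negbTE->].
move=> y /hypercube_adjP[i ->]; have [S SF iS] := h i.
by apply/bigcupP; exists S.
Qed.

(* The path e_q, e_q + e_r, e_r, etc., without its first vertex. *)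
Fixpoint zigzag q (s : seq 'I_n) : seq (n.-tuple bool) :=
  if s is r :: s' then flip r (flip q origin) :: flip r origin :: zigzag r s'
  else [::].

Lemma zigzag_path q s : path (@adj Q) (flip q origin : Q) (zigzag q s).
Proof.
elim: s q => //= r s IH q; rewrite IH andbT; apply/andP; split.
  exact: cube_adj_flip.
by rewrite flipC; apply/hypercube_adjP; exists q; rewrite flipK.
Qed.

Lemma size_zigzag q s : size (zigzag q s) = (size s).*2.
Proof. by elim: s q => //= r s IH q; rewrite IH doubleS. Qed.

Lemma mem_zigzag q s i : i \in q :: s -> flip i origin \in flip q origin :: zigzag q s.
Proof.
elim: s q => [|r s IH] q; first by rewrite !inE => /eqP->.
by rewrite inE => /orP[/eqP->|/IH]; rewrite !inE ?eqxx // => /orP[]->; rewrite ?orbT.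
Qed.

Lemma zigzag_off q s x i : x \in flip q origin :: zigzag q s ->
  i \notin q :: s -> tnth x i = false.
Proof.
elim: s q => [|r s IH] q.
  by rewrite !inE => /eqP-> /negbTE; rewrite tnth_unit.
rewrite /= 2!in_cons in_cons negb_or => xs /andP[/negbTE iq irs].
case/or3P: xs => [/eqP->|/eqP->|xs]; last exact: IH irs.
  by rewrite tnth_unit.
move: irs; rewrite ?inE negb_or => /andP[/negbTE ir _].
by rewrite tnth_flip tnth_unit iq ir.
Qed.

(** The first two vertices have coordinate [q] set and all later ones do not; these two differ in
    parity. *)
Lemma zigzag_uniq q s : uniq (q :: s) -> uniq (flip q origin :: zigzag q s).
Proof.
elim: s q => // r s IH q /= /andP[qrs rs]; have := IH r rs => /= ->.
have notin x : tnth x q -> x \notin flip r origin :: zigzag r s.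
  by move=> xq; apply/negP=> /zigzag_off/(_ qrs); rewrite xq.
have qr : (q == r) = false by move: qrs; rewrite inE negb_or => /andP[/negbTE].
rewrite andbT inE negb_or !notin ?tnth_flip ?tnth_mktuple ?eqxx ?qr // andbT.
apply/andP; split=> //; apply/eqP=> /(congr1 (@par n)).
by rewrite !par_flip; case: (par _).
Qed.

Lemma zigzag_nonzero q s : uniq (q :: s) -> origin \notin flip q origin :: zigzag q s.
Proof.
have neq x i : tnth x i -> origin != x.
  by apply: contraTneq => <-; rewrite tnth_mktuple.
elim: s q => [|r s IH] q; first by rewrite inE (neq _ q) ?tnth_unit.
move=> /andP[qrs rs] /=.
rewrite inE negb_or (neq _ q) ?tnth_unit // inE negb_or IH // andbT.
apply: (neq _ q); rewrite tnth_flip tnth_unit eqxx.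
by move: qrs; rewrite inE negb_or => /andP[/negbTE->].
Qed.

(** The directions are cut into [m] consecutive blocks of length at most [k / 2]. The first
    inequality makes the blocks cover all directions, the second makes each of them nonempty. A
    zigzag through a block of length [l] has [2 * l - 1 < k] vertices. *)
Lemma substructure_cut_exists k m : 2 < k -> ~~ odd k -> n <= m * k./2 ->
  (m - 1) * k./2 < n ->
  exists2 F : {set subgraph Q}, substructure_cut (cycle_graph k) F & #|F| <= m.
Proof.
move=> k3 ek nm mn; pose h := k./2.
have h0 : 0 < h by rewrite /h; move: k3; clear; lia.
pose block (a : 'I_m) := take h (drop (a * h) (enum 'I_n)).
have blockP (a : 'I_m) : exists S : subgraph Q,
   [&& origin \notin verts S, [forall i in block a, flip i origin \in verts S]
     & [exists T : subgraph (cycle_graph k), connected (graph_of_subgraph T)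
       && isomorphic (graph_of_subgraph S) (graph_of_subgraph T)]].
  have sz : 0 < size (block a) <= h.
    rewrite size_take_min geq_minl andbT leq_min h0 size_drop size_enum_ord subn_gt0.
    apply: leq_ltn_trans mn; rewrite leq_mul2r; apply/orP; right.
    by have := ltn_ord a; clear; lia.
  have un : uniq (block a) by rewrite take_uniq ?drop_uniq ?enum_uniq.
  case: (block a) sz un => [|q s] // /= sz un.
  have [||S vS eS] := @path_subgraph k Q _ _ (zigzag_path q s).
  - exact: zigzag_uniq.
  - by rewrite size_zigzag; move: sz; rewrite /h; clear; lia.
  exists S; rewrite eS vS inE zigzag_nonzero //= andbT.
  by apply/forall_inP=> i iqs; rewrite inE; apply: mem_zigzag.
have [f fP] := fin_all_exists blockP.
exists [set f a | a : 'I_m]; last by rewrite (leq_trans (leq_imset_card _ _)) ?card_ord.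
apply/andP; split.
  by apply/forall_inP=> _ /imsetP[a _ ->]; have /and3P[] := fP a.
apply: covering_separates => [_ /imsetP[a _ ->]|i]; first by have /and3P[] := fP a.
(* Direction [i] is found in block [i %/ h] at position [i %% h]. *)
have am : i %/ h < m by rewrite ltn_divLR // (leq_trans (ltn_ord i)).
exists (f (Ordinal am)); first exact: imset_f.
have /and3P[_ /forall_inP + _] := fP (Ordinal am); apply.
rewrite /block /=; apply/(nthP i); exists (i %% h).
  rewrite size_take_min leq_min ltn_mod h0 size_drop size_enum_ord ltn_subRL.
  by rewrite -divn_eq ltn_ord.
by rewrite nth_take ?ltn_mod // nth_drop -divn_eq nth_ord_enum.
Qed.

(** * Long cycles from reflected Gray codes *)

Fixpoint gray (s : seq 'I_n) u : seq (n.-tuple bool) :=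
  if s is a :: s' then gray s' u ++ map (flip a) (rev (gray s' u)) else [:: u].

Lemma size_gray s u : size (gray s u) = 2 ^ size s.
Proof.
by elim: s => //= a s IH; rewrite size_cat size_map size_rev IH addnn -mul2n expnS.
Qed.

Lemma gray_off s u x i : x \in gray s u -> i \notin s -> tnth x i = tnth u i.
Proof.
elim: s x => [|a s IH] x /=; first by rewrite inE => /eqP->.
rewrite mem_cat inE negb_or => xs /andP[/negbTE ia /IH{}IH].
case/orP: xs => [/IH//|/mapP[y]]; rewrite mem_rev => /IH E ->.
by rewrite tnth_flip E ia addbF.
Qed.

Lemma double_uniq s b : uniq s -> {in s &, forall x y, tnth x b = tnth y b} ->
  uniq (s ++ map (flip b) (rev s)).
Proof.
move=> us sb; rewrite cat_uniq us map_inj_uniq ?rev_uniq ?us ?andbT /=; last first.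
  exact: (inv_inj (@flipK n b)).
apply/hasPn=> _ /mapP[y + ->]; rewrite mem_rev => ys; apply/negP=> fys.
by have := sb _ _ ys fys; rewrite tnth_flip eqxx; case: (tnth y b).
Qed.

Lemma gray_uniq s u : uniq s -> uniq (gray s u).
Proof.
elim: s => //= a s IH /andP[aNs /IH us]; apply: double_uniq => // x y xs ys.
by rewrite (gray_off xs aNs) (gray_off ys aNs).
Qed.

(** Follow the path, cross in direction [b] at its end and return along its translate. This serves
    both the Gray code and the closing of a path into a cycle. *)
Lemma double_path x s b : path (@adj Q) (x : Q) s ->
  path (@adj Q) (x : Q) (s ++ map (flip b) (rev (x :: s))).
Proof.
move=> ps; rewrite cat_path ps /= rev_cons map_rcons.
have -> : rcons (map (flip b) (rev s)) (flip b x) = map (flip b) (rev (x :: s)).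
  by rewrite rev_cons map_rcons.
rewrite lastI rev_rcons /=; apply/andP; split; first exact: cube_adj_flip.
rewrite path_map rev_path; apply: sub_path ps => y z /hypercube_adjP[i ->].
apply/hypercube_adjP; exists i.
by rewrite /= flipC flipK.
Qed.

Lemma gray_path s u : exists p, gray s u = u :: p /\ path (@adj Q) (u : Q) p.
Proof.
elim: s => [|a s [p [E pp]]] /=; first by exists [::].
by rewrite E; exists (p ++ map (flip a) (rev (u :: p))); split=> //; apply: double_path.
Qed.

(** Take the first [k / 2] vertices of a Gray path from [flip i origin] and double them in a
    direction [b]. The result ends at [flip b u], next to its start [u]. *)
Lemma long_cycle i k : 2 < n -> 2 < k -> ~~ odd k -> k <= 2 ^ (n - 1) ->
  exists2 S : subgraph Q, origin \notin verts S /\ flip i origin \in verts S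
    & isomorphic (graph_of_subgraph S) (cycle_graph k).
Proof.
move=> n3 k3 ek kn; pose u := flip i origin.
have [b bi] : exists b, b != i.
  apply/existsP; apply: contraTT n3; rewrite negb_exists => /forallP h.
  rewrite -leqNgt -[n in n <= _]card_ord -cardsT (_ : setT = [set i]) ?cards1 //.
  by apply/setP=> j; rewrite !inE; have := h j; rewrite negbK => ->.
(* Omitting [i] keeps that coordinate set, so the origin is avoided; omitting [b] reserves it for
   the doubling. The Gray path has [2 ^ (n - 2)] vertices, enough for [k / 2]. *)
pose s := enum (~: [set b; i]).
have sz : size s = n - 2 by rewrite -cardE cardsCs setCK cards2 bi card_ord.
have [p [gE gp]] := gray_path s u.
have ug : uniq (u :: p) by rewrite -gE gray_uniq ?enum_uniq.
have off x j : j \in [set b; i] -> x \in u :: p -> tnth x j = tnth u j.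
  by rewrite -gE => ji /gray_off; apply; rewrite mem_enum !inE negbK -in_set2.
have szp : (size p).+1 = 2 ^ (n - 2) by rewrite -sz -(size_gray s u) gE.
have kn2 : k./2 <= 2 ^ (n - 2).
  rewrite -leq_double even_halfK // -mul2n -expnS (leq_trans kn) // leq_exp2l //.
  by move: n3; clear; lia.
pose h := k./2 - 1.
have hE : h.+1 = k./2 by rewrite /h; move: k3; clear; lia.
pose q := take h p.
have szq : (size q).+1 = k./2.
  by rewrite size_takel // -ltnS szp hE.
have qE : u :: q = take k./2 (u :: p) by rewrite -hE.
have sub : {subset u :: q <= u :: p} by rewrite qE; exact: mem_take.
have uq : uniq (u :: q) by rewrite qE take_uniq.
pose c := q ++ map (flip b) (rev (u :: q)).
have uc : uniq (u :: c).
  apply: (@double_uniq (u :: q)) => // x y /sub xp /sub yp.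
  by rewrite !(off _ b) ?set21.
have cyc : cycle (@adj Q) (u :: c : seq Q).
  rewrite /cycle rcons_path double_path ?take_path //=.
  rewrite last_cat rev_cons map_rcons last_rcons.
  by rewrite cube_adj_sym cube_adj_flip.
have [|S vS iS] := cycle_subgraph cyc uc (k := k).
  by rewrite size_cat size_map size_rev -addSn [size (_ :: _)]szq szq addnn even_halfK.
exists S => //; rewrite vS !inE eqxx; split=> //.
apply/negP; rewrite -in_cons => oc.
have : tnth origin i = tnth u i.
  move: oc; rewrite -cat_cons mem_cat => /orP[/sub/off|/mapP[y]].
    by apply; rewrite set22.
  rewrite mem_rev => /sub/off E ->; rewrite tnth_flip E ?set22 // eq_sym (negbTE bi).
  exact: addbF.
by rewrite tnth_unit tnth_mktuple eqxx.
Qed.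

End Cube.

Theorem theorem18 (n k : nat) (hn : (3 <= n)%N) (hk_even : ~~ odd k)
    (hk3 : (3 <= k)%N) (hk : (k <= 2 ^ (n - 1))%N) :
  (substructure_connectivity (hypercube n) (cycle_graph k)
     <= structure_connectivity (hypercube n) (cycle_graph k))%N
  /\ (Posz (substructure_connectivity (hypercube n) (cycle_graph k))
      = Num.ceil ((2 * n)%:R / k%:R : rat))%R.
Proof.
(* A cycle is a connected subgraph of itself, so structure cuts are substructure cuts. *)
have struct_sub (F : {set subgraph (hypercube n)}) :
    structure_cut (cycle_graph k) F -> substructure_cut (cycle_graph k) F.
  case/andP=> /forall_inP h sep; apply/andP; split=> //; apply/forall_inP=> S /h iS.
  have [T _ [iT _]] := full_subgraph (cycle_graph k).
  apply/existsP; exists T; apply/andP; split.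
    apply: isomorphic_connected iT _; apply: cycle_connected; exact: leq_trans hk3.
  exact: isomorphic_trans iS (isomorphic_sym iT).
split.
  (* [min_card] is 0 when there is no cut, so a structure cut must be exhibited: all
     k-cycles that avoid the origin. *)
  pose F := [set S : subgraph (hypercube n) |
    isomorphic (graph_of_subgraph S) (cycle_graph k) && (origin n \notin verts S)].
  have FP : structure_cut (cycle_graph k) F.
    apply/andP; split; first by apply/forall_inP=> S; rewrite inE => /andP[].
    apply: covering_separates => [S|i]; first by rewrite inE => /andP[].
    have [S [oS iS] cS] := long_cycle i hn hk3 hk_even hk.
    by exists S; rewrite // inE cS.
  apply: (min_card_ge FP) => F' F'P; apply: min_card_le; exact: struct_sub.
pose h := k./2; have kE : k = h.*2 by rewrite even_halfK.
have h0 : 0 < h by rewrite -double_gt0 -kE ltnW // ltnW.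
(* [m] is the ceiling of [n / h], that is of [2 * n / k], characterised by
   [(m - 1) * h < n <= m * h]. *)
pose m := (n.-1 %/ h).+1.
have nm : n <= m * h.
  by rewrite -[n in n <= _](@prednK n) ?ltn_ceil // ltnW // ltnW.
have mn : (m - 1) * h < n.
  by rewrite subn1 /= (leq_ltn_trans (leq_trunc_div _ _)) // prednK // ltnW // ltnW.
have [F FP Fm] := substructure_cut_exists hk3 hk_even nm mn.
have -> : substructure_connectivity (hypercube n) (cycle_graph k) = m.
  apply/eqP; rewrite eqn_leq (leq_trans (min_card_le FP)) //=.
  apply: (min_card_ge FP) => F' F'P.
  (* Any cut satisfies [n <= h * #|F'|], and [(m - 1) * h < n] then forces [m <= #|F'|]. *)
  have := substructure_cut_bound hk3 hk_even (ltnW hn) F'P.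
  rewrite {1}kE mul2n -doubleMl leq_double => le.
  have := leq_trans mn le; rewrite mulnC ltn_mul2l h0 /=.
  by clear; lia.
apply/esym/Num.Theory.ceil_def.
have k0 : (0 < k%:R :> rat)%R by rewrite Num.Theory.ltr0n (leq_trans _ hk3).
rewrite Num.Theory.ltr_pdivlMr // Num.Theory.ler_pdivrMr //.
rewrite (_ : Posz m - 1 = Posz (m - 1))%R; last by rewrite -subzn.
rewrite -!pmulrn -!GRing.natrM Num.Theory.ltr_nat Num.Theory.ler_nat.
by rewrite kE mul2n -!doubleMr ltn_double leq_double mn.
Qed.
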